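(* Consider the one-variable monadic predicate language over the vocabulary $\tau=\{P\}$, where $P$ is a unary predicate letter, with primitives $[\neg,\rightarrow,\exists]$, and let $\vdash$ stand for provability in the axiomatization (A1)–(A5), (R1)–(R2) described in the context, where $\forall x\,\phi$ abbreviates $\neg\exists x\neg\phi$. There is a two-element model $\mathfrak{A}$, with domain $A=\{u,v\}$ ($u\neq v$), and an interpretation of the primitives $[\neg,\rightarrow,\exists]$ by operations on subsets of $A$, such that for every formula $\phi$, $\vdash\phi$ only if either $\mathfrak{A}(\phi)=A$ or $\mathfrak{A}(\phi)=\{u\}$. Moreover, for this $\mathfrak{A}$ and this interpretation, $$\mathfrak{A}\big(\exists x P(x)\rightarrow\exists x\neg\neg P(x)\big)=\emptyset.$$
   Context: **Language.** There is a single individual variable $x$ and a single unary predicate letter $P$. Formulas are built from the atomic formula $P(x)$ using $\neg\phi$, $\phi\rightarrow\psi$ and $\exists x\,\phi$ (no equality). The expression $\forall x\,\phi$ is an abbreviation for $\neg\exists x\neg\phi$. **Axiomatization.** The axioms are all instances, for formulas $\phi,\psi,\chi$ of the language, of: (A1) $\phi\rightarrow(\psi\rightarrow\phi)$; (A2) $(\phi\rightarrow(\psi\rightarrow\chi))\rightarrow((\phi\rightarrow\psi)\rightarrow(\phi\rightarrow\chi))$; (A3) $(\neg\phi\rightarrow\neg\psi)\rightarrow(\psi\rightarrow\phi)$; (A4) $\forall x\,\phi(x)\rightarrow\phi(x)$; (A5) $\forall x(\phi\rightarrow\psi(x))\rightarrow(\phi\rightarrow\forall x\,\psi(x))$, where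 $x$ is not free in $\phi$. The rules are: (R1) Modus Ponens: from $\phi\rightarrow\psi$ and $\phi$ infer $\psi$; (R2) Generalization: from $\phi$ infer $\forall x\,\phi$. Write $\vdash\phi$ if $\phi$ is derivable from the axioms by these rules. **Models, interpretations of primitives, values.** A model $\mathfrak{A}$ with domain $A$ assigns to $P(x)$ a subset $\mathfrak{A}(P(x))\subseteq A$. An interpretation of the primitives (possibly nonstandard) on the domain $A$ consists of operations $f_\neg:\mathcal{P}(A)\to\mathcal{P}(A)$, $f_\exists:\mathcal{P}(A)\to\mathcal{P}(A)$ and $f_\rightarrow:\mathcal{P}(A)\times\mathcal{P}(A)\to\mathcal{P}(A)$, where $\mathcal{P}(A)$ is the power set of $A$. Given a model and such an interpretation, the value $\mathfrak{A}(\phi)\subseteq A$ of a formula is computed recursively: $\mathfrak{A}(\neg\phi)=f_\neg(\mathfrak{A}(\phi))$, $\mathfrak{A}(\phi\rightarrow\psi)=f_\rightarrow(\mathfrak{A}(\phi),\mathfrak{A}(\psi))$, $\mathfrak{A}(\exists x\,\phi)=f_\exists(\mathfrak{A}(\phi))$. *)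

(* Defs.v *)
From HB Require Import structures.
From mathcomp Require Import all_boot.

Set Implicit Arguments.
Unset Strict Implicit.
Unset Printing Implicit Defensive.

(* There is a single individual variable x, so neither the
   atom P(x) nor the quantifier carries a variable name. *)
Inductive formula : Type :=
  | FAtom : formula
  | FNeg : formula -> formula
  | FImp : formula -> formula -> formula
  | FEx : formula -> formula.

Definition FAll (phi : formula) : formula := FNeg (FEx (FNeg phi)).

Fixpoint x_free (phi : formula) : bool :=
  match phi with
  | FAtom => true
  | FNeg psi => x_free psi
  | FImp psi chi => x_free psi || x_free chi
  | FEx _ => false
  end.

(* In A4 the instantiating term can only be x itself, so no substitution
   is involved. *)
Inductive provable : formula -> Prop :=
  | A1 phi psi : provable (FImp phi (FImp psi phi))
  | A2 phi psi chi :
      provable (FImp (FImp phi (FImp psi chi))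
                     (FImp (FImp phi psi) (FImp phi chi)))
  | A3 phi psi :
      provable (FImp (FImp (FNeg phi) (FNeg psi)) (FImp psi phi))
  | A4 phi : provable (FImp (FAll phi) phi)
  | A5 phi psi : ~~ x_free phi ->
      provable (FImp (FAll (FImp phi psi)) (FImp phi (FAll psi)))
  | R1 phi psi : provable (FImp phi psi) -> provable phi -> provable psi
  | R2 phi : provable phi -> provable (FAll phi).

(* The domain is finite, so {set A} is the full power set of A. *)
Record model (A : finType) := Model { modelP : {set A} }.

Record interpretation (A : finType) := Interpretation {
  f_neg : {set A} -> {set A};
  f_imp : {set A} -> {set A} -> {set A};
  f_ex : {set A} -> {set A}
}.

Fixpoint value (A : finType) (M : model A) (I : interpretation A)
    (phi : formula) : {set A} :=
  match phi with
  | FAtom => modelP M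
  | FNeg psi => f_neg I (value M I psi)
  | FImp psi chi => f_imp I (value M I psi) (value M I chi)
  | FEx psi => f_ex I (value M I psi)
  end.

(* Main.v *)
Require Import Defs.
From HB Require Import structures.
From mathcomp Require Import all_boot.

Set Implicit Arguments.
Unset Strict Implicit.
Unset Printing Implicit Defensive.

(** Call a value designated when it contains [u].  Negation and implication
    only look at whether their arguments are designated, combine that
    classically, and answer with the full or the empty set; the quantifier is
    the standard one.  Since [f_neg] only outputs the full and the empty set,
    on which [f_ex] is the identity, [FAll phi] is designated exactly when
    [phi] is, so every axiom is classically valid in terms of designation and
    both rules preserve it.  On the other hand [f_ex] separates the
    undesignated values [[set v]] and [set0], which double negation
    collapses. *)

Definition full_if (A : finType) (b : bool) : {set A} := [set _ | b].

Definition desig_interpretation (A : finType) (u : A) : interpretation A :=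
  {| f_neg := fun X => full_if A (u \notin X);
     f_imp := fun X Y => full_if A ((u \in X) ==> (u \in Y));
     f_ex := fun X => full_if A (X != set0) |}.

(** The point [u] guarantees that the domain is inhabited; otherwise the full set would itself be
    [set0]. *)
Lemma full_if_neq0 (A : finType) (u : A) b : (full_if A b != set0) = b.
Proof. by apply/set0Pn/idP => [[x]|b_true]; [|exists u]; rewrite inE. Qed.

Section Designation.
Variables (A : finType) (u : A) (M : model A).
Let I := desig_interpretation u.

Lemma mem_value_FImp phi psi :
  (u \in value M I (FImp phi psi)) =
  ((u \in value M I phi) ==> (u \in value M I psi)).
Proof. by rewrite inE. Qed.

Lemma mem_value_FNeg phi :
  (u \in value M I (FNeg phi)) = (u \notin value M I phi).
Proof. by rewrite inE. Qed.

Lemma mem_value_FAll phi :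
  (u \in value M I (FAll phi)) = (u \in value M I phi).
Proof. by rewrite mem_value_FNeg inE (full_if_neq0 u) negbK. Qed.

Lemma provable_mem_value phi : provable phi -> u \in value M I phi.
Proof.
have memE := (mem_value_FAll, mem_value_FImp, mem_value_FNeg).
elim=> {phi} [phi psi|phi psi chi|phi psi|phi|phi psi _|phi psi _ + _|phi _];
  rewrite !memE.
- by do 2!case: (u \in _).
- by do 3!case: (u \in _).
- by do 2!case: (u \in _).
(* Once [FAll] is erased, A4 and A5 both have the form [b ==> b]. *)
- exact: implybb.
- exact: implybb.
- by move/implyP.
- by [].
Qed.

End Designation.

Theorem proposition2 :
  exists (A : finType) (u v : A) (M : model A) (I : interpretation A),
    [/\ u <> v,
        [set: A] = [set u; v],
        forall phi : formula, provable phi ->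
          value M I phi = [set: A] \/ value M I phi = [set u]
      & value M I (FImp (FEx FAtom) (FEx (FNeg (FNeg FAtom)))) = set0].
Proof.
exists bool, true, false, (Model [set false]), (desig_interpretation true).
split=> //.
- by apply/setP=> -[]; rewrite !inE.
- move=> phi /(provable_mem_value true (Model [set false])).
  (* Only [true \in X] matters now: whether [false] lies in [X] decides between the two allowed
     values. *)
  move: (value _ _ _) => X uX.
  case: (boolP (false \in X)) => vX; [left|right];
    by apply/setP=> -[]; rewrite !inE ?uX ?vX ?(negbTE vX).
- apply/setP=> x; rewrite /= !inE !(full_if_neq0 true) /=.
  (* The consequent has reduced to [false], so it remains to see that [[set false]] is nonempty. *)
  by rewrite implybF; apply/negbF/set0Pn; exists false; rewrite inE.
Qed.
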